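(* Let $V(x)$ be a real-valued $C^2$ function globally defined on $\mathbb{R}^n$. For any choice of constants $c_0,c_1\in\mathbb{R}$, every solution $x(s)$ of $$\ddot{x}=-\nabla_{x}(c_0V+c_1)^2$$ lifts to a geodesic of the $(n+2)$-dimensional Riemannian metric $g_R$ on $\mathbb{R}^{n+2}=\{(v,t,x^1,\dots,x^n)\}$ given by $$g_R=2(dv)^2-4V(x)\,dv\,dt+\tfrac12\big(1+4V(x)^2\big)(dt)^2+\sum_{i=1}^n(dx^i)^2;$$ that is, there is a geodesic of $g_R$ of the form $\gamma(s)=(\gamma^v(s),\gamma^t(s),x(s))$, with $s$ the affine parameter.
   Context: Here $\nabla_x(c_0V+c_1)^2$ denotes the Euclidean gradient on $\mathbb{R}^n$ of the function $(c_0V+c_1)^2$. In the coordinates $(v,t,x^1,\dots,x^n)$ the only nonzero components of the metric $g_R$ are $(g_R)_{vv}=2$, $(g_R)_{vt}=(g_R)_{tv}=-2V$, $(g_R)_{tt}=\frac12(1+4V^2)$, and $(g_R)_{ii}=1$ for $i=1,\dots,n$. *)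

(* Defs.v *)
From HB Require Import structures.
From mathcomp Require Import all_boot all_order all_algebra.
From mathcomp Require Import all_classical all_reals all_analysis.

Set Implicit Arguments.
Unset Strict Implicit.
Unset Printing Implicit Defensive.

Import Order.TTheory GRing.Theory Num.Theory.
Import numFieldNormedType.Exports.

Local Open Scope ring_scope.
Local Open Scope classical_set_scope.

Section Calculus.
Context {R : realType} {m : nat}.
Implicit Types (f : 'rV[R]_m -> R) (p : 'rV[R]_m).

Definition partial (i : 'I_m) f p : R := 'D_(delta_mx 0 i) f p.

Definition gradient f p : 'rV[R]_m := \row_i partial i f p.

(* In finite dimension, the differential of f is of class C^k if and only if
   all of its evaluations p |-> 'd f p v = 'D_v f p are. *)
Fixpoint Ck (k : nat) f : Prop :=
  if k is k'.+1 then
    (forall p, differentiable f p) /\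
    (forall v : 'rV[R]_m, Ck k' (fun p => 'D_v f p))
  else continuous f.

End Calculus.

Section Riemannian.
Context {R : realType} {m : nat}.
Implicit Types (g : 'rV[R]_m -> 'M[R]_m) (p : 'rV[R]_m).

Definition riemannian_metric (k : nat) g : Prop :=
  [/\ forall i j, Ck k (fun p => g p i j),
      forall p, (g p)^T = g p &
      forall p (u : 'rV[R]_m), u != 0 -> 0 < (u *m g p *m u^T) 0 0].

(* Gamma^k_ij of the Levi-Civita connection: k is the upper index. *)
Definition christoffel g (k i j : 'I_m) p : R :=
  2^-1 * \sum_l invmx (g p) k l *
    (partial i (fun q => g q j l) p + partial j (fun q => g q i l) p
     - partial l (fun q => g q i j) p).

(* The interval I is meant to be open, so that the total operator derive1
   only sees the restriction of gam to I. *)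
Definition geodesic g (I : set R) (gam : R -> 'rV[R]_m) : Prop :=
  forall s, I s ->
    [/\ derivable gam s 1, derivable (derive1 gam) s 1 &
        forall k, derive1 (derive1 gam) s 0 k
          + \sum_i \sum_j christoffel g k i j (gam s)
              * derive1 gam s 0 i * derive1 gam s 0 j = 0].

End Riemannian.

Section Lift.
Context {R : realType} {n : nat}.

Definition newton_solution (U : 'rV[R]_n -> R) (I : set R)
    (x : R -> 'rV[R]_n) : Prop :=
  forall s, I s ->
    [/\ derivable x s 1, derivable (derive1 x) s 1 &
        derive1 (derive1 x) s = - gradient U (x s)].

(* The coordinates (v, t, x^1, ..., x^n) on R^(n+2), in this order. *)
Definition coords (v t : R) (x : 'rV[R]_n) : 'rV[R]_(1 + 1 + n) :=
  row_mx (row_mx v%:M t%:M) x.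

Definition gR (V : 'rV[R]_n -> R) (p : 'rV[R]_(1 + 1 + n)) :
    'M[R]_(1 + 1 + n) :=
  let V := V (rsubmx p) in
  block_mx
    (block_mx 2%:M         (- 2 * V)%:M
              (- 2 * V)%:M (2^-1 * (1 + 4 * V ^+ 2))%:M) 0
    0 1%:M.

End Lift.

(* Main.v *)
Require Import Defs.
From HB Require Import structures.
From mathcomp Require Import all_boot all_order all_algebra.
From mathcomp Require Import all_classical all_reals all_analysis.
From mathcomp Require Import ring lra.

Set Implicit Arguments.
Unset Strict Implicit.
Unset Printing Implicit Defensive.

Import Order.TTheory GRing.Theory Num.Theory.
Import numFieldNormedType.Exports.

Local Open Scope ring_scope.
Local Open Scope classical_set_scope.

(** Complete the square: a vector (a, b, y) has g_R-length squared
    2 (a - V b)^2 + b^2 / 2 + |y|^2 ([gR_quadratic_form]).  This shows that g_R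
    is positive definite.  Half of this expression at the velocity (v', t', x')
    is the Lagrangian of the geodesics of g_R.  It depends neither on v nor on
    t, so that the two corresponding momenta
      p_v = 2 (v' - V t')   and   p_t = t' / 2 - V p_v
    are constant along a geodesic.  If p_v = c0 and p_t = c1, then
      t' = 2 (c0 V + c1)   and   v' = c0 / 2 + V t',
    and the remaining Euler-Lagrange equations
    x'' = - t' p_v (grad V) = - 2 c0 (c0 V + c1) (grad V)
    are exactly x'' = - grad (c0 V + c1)^2.

    Conversely, given a solution x, the functions t and v are obtained by
    integrating the formulas above along x ([primitive_on_open_interval]), and
    the Euler-Lagrange equations hold by construction.  No Christoffel symbol
    of g_R is computed: for any metric, the geodesic equation follows from the
    Euler-Lagrange equations ([geodesic_of_euler_lagrange]), the inverse of the
    metric being used only to raise an index. *)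

(** * Calculus on row vectors *)

Lemma CkW (R : realType) m k (f : 'rV[R]_m -> R) : Ck k.+1 f -> Ck k f.
Proof.
elim: k f => [|k IHk] f [df dDf].
  by move=> p; exact: differentiable_continuous.
by split=> // v; exact: IHk (dDf v).
Qed.

Lemma Ck_cst (R : realType) m k (c : R) : Ck k (fun _ : 'rV[R]_m => c).
Proof.
elim: k c => [|k IHk] c; first exact: cst_continuous.
split=> [p|v]; first exact: differentiable_cst.
by under [X in Ck k X]funext do rewrite derive_cst; exact: IHk.
Qed.

Lemma CkD (R : realType) m k (f g : 'rV[R]_m -> R) :
  Ck k f -> Ck k g -> Ck k (fun p => f p + g p).
Proof.
elim: k f g => [|k IHk] f g; first by move=> cf cg p; exact: continuousD (cf p) (cg p).
move=> [df dDf] [dg dDg]; split=> [p|v]; first exact: differentiableD.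
rewrite (_ : (fun p => _) = fun p => 'D_v f p + 'D_v g p).
  exact: IHk (dDf v) (dDg v).
by apply/funext => p; rewrite deriveD//; exact: diff_derivable.
Qed.

(** The Leibniz rule multiplies a first derivative, of class C^k, by an
    undifferentiated factor, of class C^(k+1): the induction closes by
    [CkW]. *)
Lemma CkM (R : realType) m k (f g : 'rV[R]_m -> R) :
  Ck k f -> Ck k g -> Ck k (fun p => f p * g p).
Proof.
elim: k f g => [|k IHk] f g; first by move=> cf cg p; exact: continuousM (cf p) (cg p).
move=> Cf Cg; have [[df dDf] [dg dDg]] := (Cf, Cg).
split=> [p|v]; first exact: differentiableM.
rewrite (_ : (fun p => _) = fun p => f p * 'D_v g p + g p * 'D_v f p).
  by apply: CkD; apply: IHk; [exact: CkW|exact: dDg|exact: CkW|exact: dDf].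
by apply/funext => p; rewrite deriveM//; exact: diff_derivable.
Qed.

(** The difference quotients of both sides coincide. *)
Lemma derive_comp_linear (R : realType) m m' (L : {linear 'rV[R]_m' -> 'rV[R]_m})
    (f : 'rV[R]_m -> R) p v :
  'D_v (fun q => f (L q)) p = 'D_(L v) f (L p).
Proof.
rewrite /derive (_ : (fun h => _) =
  fun h => h^-1 *: ((f \o shift (L p)) (h *: L v) - f (L p)))//.
by apply/funext => h /=; rewrite linearP.
Qed.

Lemma Ck_comp_linear (R : realType) m m' k
    (L : {linear 'rV[R]_m' -> 'rV[R]_m}) (f : 'rV[R]_m -> R) :
  continuous L -> Ck k f -> Ck k (fun q => f (L q)).
Proof.
move=> cL; elim: k f => [|k IHk] f.
  by move=> cf q; apply: continuous_comp; [exact: cL|exact: cf].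
move=> [df dDf]; split=> [q|v].
  by apply: (@differentiable_comp _ _ _ _ L f) => //; exact: linear_differentiable.
under [X in Ck k X]funext do rewrite derive_comp_linear.
exact: IHk (dDf _).
Qed.

Lemma derive_partial (R : realType) m (f : 'rV[R]_m -> R) p (u : 'rV[R]_m) :
  differentiable f p -> 'D_u f p = \sum_i u 0 i * partial i f p.
Proof.
move=> df; rewrite deriveE// [in LHS](row_sum_delta u) linear_sum/=.
by apply: eq_bigr => i _; rewrite linearZ/= /partial deriveE.
Qed.

Lemma is_derive_along (R : realType) m (f : 'rV[R]_m -> R) (gam : R -> 'rV[R]_m) s :
  differentiable f (gam s) -> derivable gam s 1 ->
  is_derive s 1 (fun t => f (gam t)) ('D_(derive1 gam s) f (gam s)).
Proof.
move=> df /derivable1_diffP dgam.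
have dfg : differentiable (f \o gam) s by exact: differentiable_comp.
apply: DeriveDef; first exact: diff_derivable dfg.
rewrite deriveE//; have -> : (fun t => f (gam t)) = f \o gam by [].
by rewrite diff_comp//= deriveE// derive1E'.
Qed.

Lemma is_derive_row_entry (R : realType) m (gam : R -> 'rV[R]_m) s i :
  derivable gam s 1 -> is_derive s 1 (fun t => gam t 0 i) (derive1 gam s 0 i).
Proof.
move=> dgam; apply: DeriveDef; first exact: (derivable_mxP _ _ _).1.
by rewrite derive1E derive_mx// mxE.
Qed.

Lemma is_derive_sum_fun (R : realType) (W : normedModType R) m (h : 'I_m -> W -> R)
    (dh : 'I_m -> R) (x v : W) :
  (forall i, is_derive x v (h i) (dh i)) ->
  is_derive x v (fun y => \sum_i h i y) (\sum_i dh i).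
Proof.
move=> H; have -> : (fun y => \sum_i h i y) = \sum_i h i.
  by apply/funext => y; rewrite fct_sumE.
exact: is_derive_sum.
Qed.

Lemma gradient_affine_sqr (R : realType) m (V : 'rV[R]_m -> R) (c0 c1 : R) y :
  differentiable V y ->
  gradient (fun z => (c0 * V z + c1) ^+ 2) y =
    (2 * c0 * (c0 * V y + c1)) *: gradient V y.
Proof.
move=> dV; apply/rowP => i; rewrite !mxE /partial.
have V' : is_derive y (delta_mx 0 i : 'rV[R]_m) V ('D_(delta_mx 0 i) V y).
  by apply: derivableP; exact: diff_derivable.
rewrite (_ : (fun z => _) = (c0 *: V + cst c1) ^+ 2).
  rewrite derive_val !fctE -[c0 *: V y]/(c0 * V y) expr1 addr0.
  by rewrite /GRing.scale/=; ring.
by apply/funext => z; rewrite !fctE.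
Qed.

(** * Primitives on open intervals *)

(** An open interval has no left endpoint in it from which to integrate, and
    f need not be integrable up to its ends.  So the primitive is normalised
    at a point s0 of I, and the signed integral from s0 to s is written as a
    difference of two integrals based at min(s, s0).  Near a given s, the base
    point can be replaced by any a in I that lies to the left of both s and s0;
    with a fixed base the fundamental theorem of calculus applies. *)
Lemma primitive_on_open_interval (R : realType) (I : set R) (f : R -> R) :
  open I -> is_interval I -> (forall s, I s -> {for s, continuous f}) ->
  exists F : R -> R, forall s, I s -> is_derive s 1 F (f s).
Proof.
move=> oI iI cf; have [->|/set0P[s0 Is0]] := eqVneq I set0; first by exists f.
pose mu := @lebesgue_measure R.
pose G a b := (\int[mu]_(t in `[a, b]) f t)%R.
have intf a b : I a -> I b -> mu.-integrable `[a, b] (EFin \o f).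
  move=> Ia Ib; apply: continuous_compact_integrable; first exact: segment_compact.
  apply: continuous_in_subspaceT => t /[!inE]/= tab; apply: cf.
  by apply: (iI _ _ Ia Ib); rewrite !(itvP tab).
have near_I s : I s -> exists2 e : R, 0 < e & forall t, `|s - t| < e -> I t.
  move=> Is; have /nbhs_ballP[e /= e0 sub] := open_nbhs_nbhs (conj oI Is).
  by exists e => // t st; exact: sub.
exists (fun s => G (Num.min s s0) s - G (Num.min s s0) s0) => s Is.
(* the fixed base point a, and a point b of I beyond s *)
have [a Ia [as_ as0]] : exists2 a, I a & a < s /\ a < s0.
  have Im : I (Num.min s s0) by case: (leP s s0).
  have [e e0 sub] := near_I _ Im; exists (Num.min s s0 - e / 2).
    by apply: sub; rewrite opprB addrC subrK gtr0_norm ?divr_gt0// gtr_pMr//;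
       rewrite invf_lt1// ltr1n.
  have e2 : 0 < e / 2 by rewrite divr_gt0.
  by case: (leP s s0) => ?; split; lra.
have [b Ib sb] : exists2 b, I b & s < b.
  have [e e0 sub] := near_I _ Is; exists (s + e / 2).
    by apply: sub; rewrite opprD addNKr normrN gtr0_norm ?divr_gt0// gtr_pMr//;
       rewrite invf_lt1// ltr1n.
  by rewrite ltrDl divr_gt0.
have [dG G'] : derivable (G a) s 1 /\ derive1 (G a) s = f s.
  apply: (@continuous_FTC1_closed _ _ _ _ b) => //; [exact: intf|exact: cf].
have dGB : is_derive s 1 (fun t => G a t - G a s0) (f s).
  have dGa : is_derive s 1 (G a) (f s) by apply: DeriveDef; [exact: dG|rewrite -derive1E].
  by apply: is_derive_eq; rewrite subr0.
apply: near_eq_is_derive dGB.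
near=> t.
have at_ : a < t by near: t; exact: lt_nbhsr.
have tb : t < b by near: t; exact: lt_nbhsl.
have It : I t by apply: (iI _ _ Ia Ib); rewrite !ltW.
(* the integrals over [a, m] cancel, so that the base m may be moved to a *)
set m := Num.min t s0.
have Im : I m by rewrite /m; case: (leP t s0).
have am : a <= m by rewrite le_min !ltW.
have split_int c : I c -> m <= c ->
    G a c = G a m + G m c.
  move=> Ic mc; have := @Rintegral_itvB _ f (BLeft a) (BRight c) m.
  rewrite !bnd_simp => /(_ (intf _ _ Ia Ic) am mc) H.
  rewrite -(subrK (G a m) (G a c)) addrC; congr (_ + _).
  rewrite [LHS]H Rintegral_itv_obnd_cbnd//.
  by apply: integrableS (intf _ _ Im Ic) => //; apply: subset_itvr; rewrite bnd_simp.
rewrite (split_int t)// ?ge_min ?lexx// (split_int s0)// ?ge_min ?lexx ?orbT//.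
by rewrite opprD addrACA subrr add0r.
Unshelve. all: by end_near. Qed.

(** * Geodesics from the Euler-Lagrange equations *)

Lemma posdef_unitmx (R : realType) m (A : 'M[R]_m) :
  (forall u : 'rV[R]_m, u != 0 -> 0 < (u *m A *m u^T) 0 0) -> A \in unitmx.
Proof.
move=> A_gt0; rewrite unitmxE unitfE; apply/det0P => -[u u0 uA].
by have := A_gt0 _ u0; rewrite uA mul0mx mxE ltxx.
Qed.

(** Here p_l = sum_j u^j g_jl is the momentum of the curve, u being its
    velocity.  The derivative of the factor g_jl along the curve produces the
    terms (d_i g_jl) u^i u^j. *)
Lemma derive_momentum (R : realType) m (g : 'rV[R]_m -> 'M[R]_m)
    (gam : R -> 'rV[R]_m) s l :
  (forall i j p, differentiable (fun q => g q i j) p) ->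
  derivable gam s 1 -> derivable (derive1 gam) s 1 ->
  derive1 (fun t => (derive1 gam t *m g (gam t)) 0 l) s =
    (derive1 (derive1 gam) s *m g (gam s)) 0 l +
    \sum_i \sum_j partial i (fun q => g q j l) (gam s) *
       derive1 gam s 0 i * derive1 gam s 0 j.
Proof.
move=> dg d1 d2.
have H : is_derive s 1 (fun t => \sum_j derive1 gam t 0 j * g (gam t) j l)
   (\sum_j (derive1 gam s 0 j * 'D_(derive1 gam s) (fun q => g q j l) (gam s)
      + g (gam s) j l * derive1 (derive1 gam) s 0 j)).
  apply: is_derive_sum_fun => j.
  have da := is_derive_row_entry j d2.
  have db := is_derive_along (dg j l (gam s)) d1.
  exact: is_deriveM.
under eq_fun do rewrite mxE.
rewrite derive1E derive_val big_split/= addrC mxE; congr (_ + _).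
  by apply: eq_bigr => j _; rewrite mulrC.
rewrite exchange_big/=; apply: eq_bigr => j _.
rewrite derive_partial// mulr_sumr; apply: eq_bigr => i _; ring.
Qed.

Lemma partial_quadratic_form (R : realType) m (g : 'rV[R]_m -> 'M[R]_m)
    (u p : 'rV[R]_m) l :
  (forall i j p, differentiable (fun q => g q i j) p) ->
  partial l (fun q => (u *m g q *m u^T) 0 0) p =
    \sum_i \sum_j partial l (fun q => g q i j) p * u 0 i * u 0 j.
Proof.
move=> dg.
have -> : (fun q => (u *m g q *m u^T) 0 0) =
    fun q => \sum_i \sum_j u 0 i * u 0 j * g q i j.
  apply/funext => q; rewrite mxE exchange_big/=; apply: eq_bigr => j _.
  rewrite !mxE mulr_suml; apply: eq_bigr => i _; ring.
suff H : is_derive p (delta_mx 0 l : 'rV[R]_m)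
    (fun q => \sum_i \sum_j u 0 i * u 0 j * g q i j)
    (\sum_i \sum_j partial l (fun q => g q i j) p * u 0 i * u 0 j).
  by rewrite /partial derive_val.
apply: is_derive_sum_fun => i; apply: is_derive_sum_fun => j.
rewrite (_ : _ * _ * _ = (u 0 i * u 0 j) *: partial l (fun q => g q i j) p).
  apply: is_deriveZ; apply: derivableP; exact: diff_derivable.
by rewrite /GRing.scale/=; ring.
Qed.

(** Expanding the derivative of the momentum, the Euler-Lagrange equation of
    index l says that sum_j u'^j g_jl + w_l = 0, where w_l is the contraction
    of the Christoffel symbols of the first kind with the velocity u, twice:
    symmetrising the term (d_i g_jl) u^i u^j in i and j produces the first two
    of their three terms.
    The geodesic equation is this one multiplied by the inverse of g. *)
Lemma geodesic_of_euler_lagrange (R : realType) m (g : 'rV[R]_m -> 'M[R]_m)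
    (I : set R) (gam : R -> 'rV[R]_m) :
  (forall i j p, differentiable (fun q => g q i j) p) ->
  (forall p, (g p)^T = g p) -> (forall p, g p \in unitmx) ->
  (forall s, I s ->
    [/\ derivable gam s 1, derivable (derive1 gam) s 1 &
      forall l, derive1 (fun t => (derive1 gam t *m g (gam t)) 0 l) s =
        2^-1 * partial l
          (fun q => (derive1 gam s *m g q *m (derive1 gam s)^T) 0 0) (gam s)]) ->
  geodesic g I gam.
Proof.
move=> dg gT gu EL s Is; have [d1 d2 ELs] := EL s Is; split=> // k.
set u := derive1 gam s; set a := derive1 (derive1 gam) s; set p := gam s.
pose w : 'rV[R]_m := \row_l \sum_i \sum_j 2^-1 *
  (partial i (fun q => g q j l) p + partial j (fun q => g q i l) p
   - partial l (fun q => g q i j) p) * u 0 i * u 0 j.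
have low : a *m g p + w = 0.
  apply/rowP => l; rewrite [LHS]mxE [w _ _]mxE [RHS]mxE.
  have := ELs l; rewrite derive_momentum// partial_quadratic_form//.
  rewrite -/u -/a -/p.
  move=> /eqP; rewrite -subr_eq0 => /eqP E.
  rewrite -[RHS]E -addrA; congr (_ + _).
  set S := \sum_i \sum_j _ in E *.
  (* symmetrisation in i and j *)
  have -> : S = 2^-1 *
      (S + \sum_i \sum_j partial j (fun q => g q i l) p * u 0 i * u 0 j).
    rewrite [X in _ * (_ + X)]exchange_big/= (_ : \sum_(j < m) _ = S); last first.
      by apply: eq_bigr => i _; apply: eq_bigr => j _; ring.
    by field.
  rewrite -mulrBr /S -!big_split/= -sumrB mulr_sumr.
  apply: eq_bigr => i _; rewrite -!big_split/= -sumrB mulr_sumr.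
  by apply: eq_bigr => j _; ring.
have inv_sym l : invmx (g p) k l = invmx (g p) l k.
  by rewrite -[in LHS](gT p) -trmx_inv mxE.
have -> : \sum_i \sum_j christoffel g k i j p * u 0 i * u 0 j =
    (w *m invmx (g p)) 0 k.
  rewrite mxE.
  under [RHS]eq_bigr => l _ do rewrite mxE mulr_suml.
  rewrite [RHS]exchange_big/=; apply: eq_bigr => i _.
  under [RHS]eq_bigr => l _ do rewrite mulr_suml.
  rewrite [RHS]exchange_big/=; apply: eq_bigr => j _.
  rewrite /christoffel mulr_sumr !mulr_suml; apply: eq_bigr => l _.
  by rewrite -inv_sym; ring.
rewrite -/a -(mulmxK (gu p) a).
rewrite (_ : _ + _ = ((a *m g p + w) *m invmx (g p)) 0 k); last first.
  by rewrite mulmxDl [RHS]mxE.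
by rewrite low mul0mx mxE.
Qed.

(** * The metric g_R *)

Section Lift.
Context {R : realType} {n : nat}.
Implicit Types (V : 'rV[R]_n -> R) (x y : 'rV[R]_n) (a b : R).

(** The covector of momenta (p_v, p_t, p_x) of the velocity (a, b, y).  Both of
    its first components are written with a - V b, the combination that the
    conservation of p_v keeps constant. *)
Lemma coords_mul_gR a b y V p :
  coords a b y *m gR V p =
  coords (2 * (a - V (rsubmx p) * b))
    (2^-1 * b - 2 * V (rsubmx p) * (a - V (rsubmx p) * b)) y.
Proof.
rewrite /coords /gR /= mul_row_block !mulmx0 mulmx1 addr0 add0r.
rewrite mul_row_block -!scalar_mxM -!raddfD/=.
by congr (row_mx (row_mx _%:M _%:M) _); field.
Qed.

Lemma gR_quadratic_form a b y V p :
  (coords a b y *m gR V p *m (coords a b y)^T) 0 0 =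
  2 * (a - V (rsubmx p) * b) ^+ 2 + 2^-1 * b ^+ 2 + (y *m y^T) 0 0.
Proof.
rewrite coords_mul_gR /coords !tr_row_mx !mul_row_col !tr_scalar_mx.
rewrite -!scalar_mxM -!raddfD/= mxE [X in X + _]mxE eqxx mulr1n.
by congr (_ + _); field.
Qed.

Lemma coords_surj (u : 'rV[R]_(1 + 1 + n)) : exists a b y, u = coords a b y.
Proof.
exists (lsubmx (lsubmx u) 0 0), (rsubmx (lsubmx u) 0 0), (rsubmx u).
by rewrite /coords -!mx11_scalar !hsubmxK.
Qed.

(** Every entry of g_R is a polynomial in V, composed with the projection to
    the x coordinates. *)
Lemma gR_entries_Ck k V : Ck k V -> forall i j, Ck k (fun p => gR V p i j).
Proof.
move=> CV.
have CVr : Ck k (fun p : 'rV[R]_(1 + 1 + n) => V (rsubmx p)).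
  by apply: Ck_comp_linear CV; exact: continuous_rsubmx.
move=> i j; rewrite /gR.
case: (split_ordP i) => {}i ->; case: (split_ordP j) => {}j ->; last 3 first.
- under [X in Ck k X]funext do rewrite block_mxEur; exact: Ck_cst.
- under [X in Ck k X]funext do rewrite block_mxEdl; exact: Ck_cst.
- under [X in Ck k X]funext do rewrite block_mxEdr; exact: Ck_cst.
under [X in Ck k X]funext do rewrite block_mxEul.
case: (split_ordP i) => {}i ->; case: (split_ordP j) => {}j ->; rewrite !ord1.
- under [X in Ck k X]funext do rewrite block_mxEul; exact: Ck_cst.
- under [X in Ck k X]funext do rewrite block_mxEur mxE.
  by apply: CkM CVr; exact: Ck_cst.
- under [X in Ck k X]funext do rewrite block_mxEdl mxE.
  by apply: CkM CVr; exact: Ck_cst.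
- under [X in Ck k X]funext do rewrite block_mxEdr mxE expr2.
  apply: CkM; first exact: Ck_cst.
  apply: CkD; first exact: Ck_cst.
  by apply: CkM; [exact: Ck_cst|exact: CkM].
Qed.

Lemma gR_sym V p : (gR V p)^T = gR V p.
Proof. by rewrite /gR !tr_block_mx !tr_scalar_mx !trmx0. Qed.

Lemma gR_posdef V p (u : 'rV[R]_(1 + 1 + n)) :
  u != 0 -> 0 < (u *m gR V p *m u^T) 0 0.
Proof.
have [a [b [y ->]]] := coords_surj u; rewrite gR_quadratic_form.
have yy : (y *m y^T) 0 0 = \sum_i y 0 i ^+ 2.
  by rewrite mxE; apply: eq_bigr => i _; rewrite mxE.
have y_ge0 : 0 <= (y *m y^T) 0 0 by rewrite yy sumr_ge0// => i _; exact: sqr_ge0.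
move=> u0; rewrite lt_neqAle addr_ge0 ?andbT//; last first.
  by rewrite addr_ge0// mulr_ge0// sqr_ge0.
apply: contra u0; rewrite eq_sym => /eqP E.
have A_ge0 := sqr_ge0 (a - V (rsubmx p) * b); have b_ge0 := sqr_ge0 b.
have [/eqP A0 [/eqP b0 /eqP y0]] : (a - V (rsubmx p) * b) ^+ 2 = 0 /\
    b ^+ 2 = 0 /\ (y *m y^T) 0 0 = 0 by split; [|split]; lra.
move: A0 b0; rewrite !sqrf_eq0 => + /eqP b0; rewrite b0 mulr0 subr0 => /eqP a0.
move: y0; rewrite yy psumr_eq0; last by move=> i _; exact: sqr_ge0.
move=> /allP y0.
have -> : y = 0.
  apply/rowP => i; rewrite mxE; apply/eqP; rewrite -sqrf_eq0.
  exact: y0 (mem_index_enum i).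
by rewrite a0 /coords !raddf0 !row_mx0.
Qed.

Lemma riemannian_metric_gR k V : Ck k V -> riemannian_metric k (gR V).
Proof.
by move=> CV; split; [exact: gR_entries_Ck|exact: gR_sym|exact: gR_posdef].
Qed.

Lemma derivable_coords (v t : R -> R) (x : R -> 'rV[R]_n) (s dv dt : R) :
  is_derive s 1 v dv -> is_derive s 1 t dt -> derivable x s 1 ->
  derivable (fun r => coords (v r) (t r) (x r)) s 1 /\
  derive1 (fun r => coords (v r) (t r) (x r)) s = coords dv dt (derive1 x s).
Proof.
move=> v' t' x'.
have H j : is_derive s 1 (fun r => coords (v r) (t r) (x r) 0 j)
    (coords dv dt (derive1 x s) 0 j).
  rewrite /coords; case: (split_ordP j) => {}j ->.
    under eq_fun do rewrite row_mxEl; rewrite row_mxEl.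
    case: (split_ordP j) => {}j ->; rewrite ord1.
      by under eq_fun do rewrite row_mxEl mxE; rewrite row_mxEl mxE.
    by under eq_fun do rewrite row_mxEr mxE; rewrite row_mxEr mxE.
  under eq_fun do rewrite row_mxEr; rewrite row_mxEr.
  exact: is_derive_row_entry.
have d : derivable (fun r => coords (v r) (t r) (x r)) s 1.
  by apply/derivable_mxP => i j; rewrite ord1.
split=> //; rewrite derive1E derive_mx//; apply/rowP => j.
by rewrite mxE derive_val.
Qed.

(** The right-hand side of the Euler-Lagrange equations.  Its v and t
    components vanish since V does not depend on these coordinates, whence
    the conservation of the two momenta. *)
Lemma partial_gR_quadratic_form V a b y p l :
  differentiable V (rsubmx p) ->
  partial l (fun q => (coords a b y *m gR V q *m (coords a b y)^T) 0 0) p =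
  - (4 * b * (a - V (rsubmx p) * b)) * coords 0 0 (gradient V (rsubmx p)) 0 l.
Proof.
move=> dV; rewrite /partial; under eq_fun do rewrite gR_quadratic_form.
set c : R := (y *m y^T) 0 0.
have dF : derivable V (rsubmx p) (rsubmx (delta_mx 0 l)) by exact: diff_derivable.
rewrite (derive_comp_linear rsubmx
  (fun x => 2 * (a - V x * b) ^+ 2 + 2^-1 * b ^+ 2 + c)).
have V' := derivableP dF.
set v := rsubmx (delta_mx 0 l) in V' *.
have -> : 'D_v (fun x => 2 * (a - V x * b) ^+ 2 + 2^-1 * b ^+ 2 + c) (rsubmx p) =
   - (4 * b * (a - V (rsubmx p) * b)) * 'D_v V (rsubmx p).
  have -> : (fun x => 2 * (a - V x * b) ^+ 2 + 2^-1 * b ^+ 2 + c) =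
      cst (2 * a ^+ 2 + 2^-1 * b ^+ 2 + c) - (4 * a * b) *: V
        + (2 * b ^+ 2) *: (V * V).
    by apply/funext => x; rewrite !fctE /= /GRing.scale/=; ring.
  rewrite derive_val /GRing.scale/= sub0r.
  by move: ('D_v V _) (V _) => DV Vp; ring.
congr (_ * _); rewrite /coords /v; case: (split_ordP l) => j ->.
  rewrite row_mxEl (_ : rsubmx (delta_mx 0 _) = 0) ?derive0.
    by case: (split_ordP j) => i ->; rewrite ?row_mxEl ?row_mxEr raddf0 mxE.
  by apply/rowP => i; rewrite !mxE/= eq_rlshift.
rewrite row_mxEr mxE; congr ('D_ _ _ _).
by apply/rowP => i; rewrite !mxE/= eq_rshift.
Qed.

End Lift.

(** * Lifting the solutions *)

Theorem theorem5 (R : realType) (n : nat) (V : 'rV[R]_n -> R) (hV : Ck 2 V) :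
  riemannian_metric 2 (gR V) /\
  (forall (c0 c1 : R) (I : set R) (x : R -> 'rV[R]_n),
     open I -> is_interval I ->
     newton_solution (fun y => (c0 * V y + c1) ^+ 2) I x ->
     exists gv gt : R -> R,
       geodesic (gR V) I (fun s => coords (gv s) (gt s) (x s))).
Proof.
have [dV _] := hV; have gR2 := riemannian_metric_gR hV; split=> //.
move=> c0 c1 I x oI iI xP.
(* the solution of p_v = c0 and p_t = c1 for the velocities of t and v *)
pose t' s := 2 * (c0 * V (x s) + c1).
pose v' s := 2^-1 * c0 + V (x s) * t' s.
have Vx_der s : I s -> derivable (fun r => V (x r)) s 1.
  by move=> /xP[dx _ _]; have [] := is_derive_along (dV (x s)) dx.
have t'_der s : I s -> derivable t' s 1.
  move=> Is; apply: derivableZ; apply: derivableD => //.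
  by apply: derivableZ; exact: Vx_der.
have v'_der s : I s -> derivable v' s 1.
  move=> Is; apply: derivableD => //.
  by apply: derivableM; [exact: Vx_der|exact: t'_der].
have der_cts (f : R -> R) s : derivable f s 1 -> {for s, continuous f}.
  by move=> df; apply: differentiable_continuous; exact/derivable1_diffP.
have [gt gtP] := primitive_on_open_interval oI iI
  (fun s Is => der_cts _ _ (t'_der s Is)).
have [gv gvP] := primitive_on_open_interval oI iI
  (fun s Is => der_cts _ _ (v'_der s Is)).
exists gv, gt; set gam := fun s => _.
have near_I s : I s -> \forall r \near s, I r by move=> Is; exact: open_nbhs_nbhs.
have gamP s : I s -> derivable gam s 1 /\
    derive1 gam s = coords (v' s) (t' s) (derive1 x s).
  by move=> Is; have [dx _ _] := xP s Is;
     apply: derivable_coords => //; [exact: gvP|exact: gtP].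
have [Ck_gR gR_T gR_gt0] := gR2.
apply: geodesic_of_euler_lagrange => //.
- by move=> i j p; have [+ _] := Ck_gR i j; exact.
- by move=> p; apply: posdef_unitmx; exact: gR_gt0.
move=> s Is; have [dgam gam'E] := gamP s Is; have [dx ddx newton] := xP s Is.
split; first exact: dgam.
  apply: (@near_eq_derivable _ _ _ (fun r => coords (v' r) (t' r) (derive1 x r))).
    by apply: filterS (near_I s Is) => r Ir; rewrite (gamP r Ir).2.
  by apply: (derivable_coords _ _ ddx).1; apply: derivableP; [exact: v'_der|exact: t'_der].
(* near s, the momentum of the lift is (c0, c1, x') *)
move=> l; rewrite gam'E partial_gR_quadratic_form//.
rewrite derive1E (@near_eq_derive _ _ _ _ (fun r => coords c0 c1 (derive1 x r) 0 l)); last first.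
  apply: filterS (near_I s Is) => r Ir.
  rewrite (gamP r Ir).2 coords_mul_gR /gam /coords row_mxKr.
  by congr (row_mx (row_mx _%:M _%:M) _ _ _); rewrite /v' /t'; field.
have [dc c'E] := derivable_coords (is_derive_cst c0 s 1) (is_derive_cst c1 s 1) ddx.
have [_ ->] := is_derive_row_entry l dc.
rewrite c'E newton {1}/gam /coords row_mxKr.
rewrite gradient_affine_sqr//; case: (split_ordP l) => j ->.
  by case: (split_ordP j) => i ->; rewrite !row_mxEl ?row_mxEr raddf0 mxE !mulr0.
by rewrite !row_mxEr !mxE /v' /t'; field.
Qed.
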